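(* For every integer $p\geq 2$ it holds that $\mathrm{dim}(\Theta_{p,p,p})=\mathrm{dim}(\Theta_{p,p,p+2})=3$.
   Context: All graphs are finite, simple and connected. For positive integers $p\le q\le r$ (with $q\ge 2$, so that the graph is simple), $\Theta_{p,q,r}$ denotes the graph consisting of two distinct vertices $u,v$ joined by three internally vertex-disjoint paths of lengths (numbers of edges) $p$, $q$ and $r$. For vertices $x,y$ of a graph $G$, $d(x,y)$ is the length of a shortest path between them. A vertex $s$ distinguishes two vertices $x,x'$ if $d(s,x)\neq d(s,x')$. A set $S\subseteq V(G)$ is a vertex metric generator if every pair of distinct vertices of $G$ is distinguished by some $s\in S$. The vertex metric dimension $\mathrm{dim}(G)$ is the size of a smallest vertex metric generator of $G$. *)

(* Defs.v *)
From mathcomp Require Import all_boot.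

Set Implicit Arguments.
Unset Strict Implicit.
Unset Printing Implicit Defensive.

Section MetricDimension.

Variables (T : finType) (e : rel T).
Implicit Types (x y s : T) (S : {set T}).

Definition walk_of_length x y (n : nat) : bool :=
  [exists t : n.-tuple T, path e x t && (last x t == y)].

(* The search may stop at #|T|: a shortest path has fewer than #|T| edges.
   The value is #|T| when y is not reachable from x. *)
Definition dist x y : nat := find (walk_of_length x y) (iota 0 #|T|).

Definition distinguishes s x y : bool := dist s x != dist s y.

Definition vertex_metric_generator S : bool :=
  [forall x, forall y, (x != y) ==> [exists s in S, distinguishes s x y]].

(* setT is always a vertex metric generator (see below), so this is a genuine
   minimum. *)
Definition metric_dim : nat :=
  #|[arg min_(S < [set: T] | vertex_metric_generator S) #|S|]|.

Lemma dist_min x (c : seq T) : path e x c -> dist x (last x c) <= size c.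
Proof.
move=> pc; have [ltc|] := ltnP (size c) #|T|; last first.
  by apply: leq_trans; rewrite -[X in _ <= X](size_iota 0) find_size.
rewrite leqNgt; apply/negP => /(before_find 0) /negbT /negP; apply.
rewrite nth_iota // add0n; apply/existsP; exists (in_tuple c).
by rewrite pc eqxx.
Qed.

Lemma dist_path x y :
  connect e x y -> exists c, [/\ path e x c, last x c = y & size c = dist x y].
Proof.
case/connectP=> c0 pc0 ->; case/shortenP: pc0 => c pc uc _.
have ltc : size c < #|T|.
  by have := max_card [in x :: c]; rewrite (card_uniqP uc).
have hasw : has (walk_of_length x (last x c)) (iota 0 #|T|).
  apply/hasP; exists (size c); first by rewrite mem_iota.
  by apply/existsP; exists (in_tuple c); rewrite pc eqxx.
have := nth_find 0 hasw.
rewrite nth_iota; last by move: hasw; rewrite has_find size_iota.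
rewrite add0n => /existsP[t /andP[pt /eqP lt]].
by exists t; rewrite size_tuple.
Qed.

Lemma dist_eq0 x y : (dist x y == 0) = (x == y).
Proof.
apply/eqP/eqP => [d0|<-]; last first.
  by apply/eqP; rewrite -leqn0 (@dist_min x [::]).
have T0 : 0 < #|T| by apply/card_gt0P; exists x.
have hasw : has (walk_of_length x y) (iota 0 #|T|).
  by rewrite has_find size_iota -/(dist x y) d0.
have := nth_find 0 hasw; rewrite -/(dist x y) d0 nth_iota // addn0.
by case/existsP=> t; rewrite tuple0 /= => /eqP.
Qed.

Lemma vertex_metric_generator_setT : vertex_metric_generator [set: T].
Proof.
apply/forallP => x; apply/forallP => y; apply/implyP => xy.
apply/existsP; exists x; rewrite inE /distinguishes /=.
have /eqP -> : dist x x == 0 by rewrite dist_eq0.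
by rewrite eq_sym dist_eq0.
Qed.

End MetricDimension.

Section Theta.

Variables p q r : nat.

Definition theta_length (i : 'I_3) : nat := tnth [tuple p; q; r] i.

Definition theta_vertex : finType :=
  (bool + {i : 'I_3 & 'I_(theta_length i).-1})%type.

Definition theta_u : theta_vertex := inl false.
Definition theta_v : theta_vertex := inl true.

(* The internal vertex of the i-th path reached after j + 1 edges from u. *)
Definition theta_inner (i : 'I_3) (j : 'I_(theta_length i).-1) : theta_vertex :=
  inr (Tagged (fun i0 => 'I_(theta_length i0).-1) j).

(* The k-th vertex of the i-th path, for 0 <= k <= theta_length i. *)
Definition theta_point (i : 'I_3) (k : nat) : theta_vertex :=
  if k == 0 then theta_u
  else if (insub k.-1 : option 'I_(theta_length i).-1) is Some j
       then theta_inner j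
       else theta_v.

(* Meaningful when p, q, r > 0 and at most one of them is 1: several paths of
   length 1 would collapse into a single edge. *)
Definition theta : rel theta_vertex := fun x y =>
  [exists i : 'I_3, exists k : 'I_(theta_length i),
    ((x == theta_point i k) && (y == theta_point i k.+1))
    || ((y == theta_point i k) && (x == theta_point i k.+1))].

Lemma theta_point_inner (i : 'I_3) (j : 'I_(theta_length i).-1) :
  theta_point i j.+1 = theta_inner j.
Proof. by rewrite /theta_point /= valK. Qed.

Lemma theta_point_end (i : 'I_3) : 0 < theta_length i ->
  theta_point i (theta_length i) = theta_v.
Proof. by rewrite /theta_point; case: eqP => [->//|_ _]; rewrite insubF ?ltnn. Qed.

Lemma theta_sym : symmetric theta.
Proof.
by move=> x y; apply: eq_existsb => i; apply: eq_existsb => k; rewrite orbC.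
Qed.

Lemma theta_irrefl : irreflexive theta.
Proof.
suff neq (i : 'I_3) (k : 'I_(theta_length i)) :
    theta_point i k != theta_point i k.+1.
  move=> x; apply/negbTE/negP => /existsP[i /existsP[k]].
  by rewrite orbb => /andP[/eqP -> ]; apply/negP.
case: k => -[|k] /= lt; first by rewrite /theta_point /=; case: (insub _).
have lt' : k < (theta_length i).-1 by rewrite -ltnS prednK // (ltn_trans _ lt).
rewrite (theta_point_inner (Ordinal lt')) [theta_point _ _.+2]/theta_point /=.
case ij: (insub _) => [j|//].
have jE : j = k.+1 :> nat by move: ij; case: insubP => // j' _ <- [->].
apply/eqP => -[] /eqP; rewrite -tag_eqE /tag_eq /= eqxx /=.
by rewrite tagged_asE -val_eqE /= jE ltn_eqF.
Qed.

Lemma theta_connected : 0 < p -> 0 < q -> 0 < r ->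
  forall x y, connect theta x y.
Proof.
move=> p0 q0 r0.
have l0 (i : 'I_3) : 0 < theta_length i by case: i => -[|[|[|]]].
have cu (i : 'I_3) k :
    k <= theta_length i -> connect theta theta_u (theta_point i k).
  elim: k => [|k IH] lt; first exact: connect0.
  apply: connect_trans (IH (ltnW lt)) (connect1 _).
  by apply/existsP; exists i; apply/existsP; exists (Ordinal lt); rewrite !eqxx.
suff ux x : connect theta theta_u x.
  by move=> x y; apply: connect_trans (ux y); rewrite (sym_connect_sym theta_sym).
case: x => [[]|[i j]].
- by rewrite -[inl true](theta_point_end (l0 ord0)); apply: cu.
- exact: connect0.
- rewrite -[inr _](theta_point_inner j); apply: cu.
  exact: leq_trans (ltn_ord j) (leq_pred _).
Qed.

End Theta.

Arguments theta_length p q r i : clear implicits.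
Arguments theta_u p q r : clear implicits.
Arguments theta_v p q r : clear implicits.
Arguments theta_point p q r i k : clear implicits.
Arguments theta p q r x y : clear implicits.

(* Main.v *)
Require Import Defs.
From mathcomp Require Import all_boot.
From mathcomp Require Import zify.

Set Implicit Arguments.
Unset Strict Implicit.
Unset Printing Implicit Defensive.

(** Write a vertex of [theta p p r] as the [k]-th vertex of its [i]-th path,
    with the ends [u] and [v] lying on all three paths, and let
    [p <= r <= p + 2]. Two vertices on different paths are joined by a shortest
    path through [u] or through [v]; two vertices on the same path are joined by
    a shortest path along it or around through a path of length [p]. This closed
    formula ([dist_theta]) turns the theorem into linear arithmetic on
    coordinates.

    Upper bound: the distance to [u] determines the position [k] along a path
    (up to one coincidence, between [v] and a vertex of the third path when
    [r = p + 2]), and the neighbours of [u] on two paths of length [p] resolve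
    what remains.

    Lower bound, for [r = p] and [r = p + 2]: any two vertices [s], [t] leave
    some pair [x], [y] undistinguished ([unresolved_pair]). If [s] and [t] lie on
    a common path, then [x] and [y] are the neighbours of [u], or those of [v],
    on the other two paths. Otherwise [s] and [t] are internal vertices of two
    different paths, which form a cycle of even length. If they are antipodal on
    it, [x] and [y] are the neighbours of [s] on its path. If not, by the symmetry
    exchanging [u] and [v] it may be assumed that the shorter arc of the cycle
    from [s] to [t] passes through [u]. Let [k] be the distance along the cycle
    between [t] and the antipode of [s], which is also the distance between [s]
    and the antipode of [t]. Then [x] is the vertex at distance [k] from [u] on
    the remaining path, and [y] is the reflection in [s] of the vertex at
    distance [k] from [u] on the path of [t], provided that it lies on the path of
    [s]; if it does not, then the same works with [s] and [t] exchanged. *)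

(** * Distances and metric generators in finite graphs *)

(** A function that vanishes exactly at [s], grows by at most one along each edge
    and decreases towards some neighbour at every other vertex is the distance
    from [s]. *)
Lemma dist_characterization (T : finType) (e : rel T) (s : T) (f : T -> nat) :
    (forall x, (f x == 0) = (x == s)) ->
    (forall x y, e x y -> f y <= (f x).+1) ->
    (forall x, x != s -> exists2 y, e y x & f y < f x) ->
  forall x, dist e s x = f x.
Proof.
move=> f0 f_lip f_desc x.
have fs0 : f s = 0 by apply/eqP; rewrite f0.
have walk n y : f y <= n ->
    exists c, [/\ path e s c, last s c = y & size c <= f y].
  elim: n y => [|n IH] y fy; have [->|ys] := eqVneq y s; try by exists [::].
    by move: ys; rewrite -f0 -leqn0 fy.
  have [z ezy fzy] := f_desc y ys.
  have [c [pc lc sc]] := IH z (leq_trans fzy fy).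
  exists (rcons c y); rewrite rcons_path pc lc ezy last_rcons size_rcons.
  by split=> //; apply: leq_trans fzy.
have f_path c y : path e y c -> f (last y c) <= f y + size c.
  elim: c y => [|z c IH] y /=; first by rewrite addn0.
  by case/andP=> /f_lip yz /IH zc; rewrite addnS -addSn (leq_trans zc) ?leq_add2r.
have [c [pc lc sc]] := walk _ x (leqnn _).
apply/eqP; rewrite eqn_leq; apply/andP; split.
  by apply: leq_trans sc; rewrite -lc dist_min.
have sx : connect e s x by apply/connectP; exists c.
have [c' [pc' <- <-]] := dist_path sx.
by have := f_path _ _ pc'; rewrite fs0.
Qed.

Lemma metric_dim_le (T : finType) (e : rel T) (S : {set T}) :
  vertex_metric_generator e S -> metric_dim e <= #|S|.
Proof.
rewrite /metric_dim => genS.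
by case: arg_minnP => [|S' _]; [exact: vertex_metric_generator_setT|exact].
Qed.

Lemma metric_dim_gt2 (T : finType) (e : rel T) (x0 : T) :
    (forall s t, exists x y, [/\ x != y, dist e s x = dist e s y
                                & dist e t x = dist e t y]) ->
  2 < metric_dim e.
Proof.
rewrite /metric_dim => unresolved.
case: arg_minnP => [|S genS _]; first exact: vertex_metric_generator_setT.
have no_cover s t : ~ {subset S <= [set s; t]}.
  move=> sub; have [x [y [xy sxy txy]]] := unresolved s t.
  move/forallP/(_ x)/forallP/(_ y)/implyP/(_ xy)/existsP: genS => -[w].
  case/andP=> /sub; rewrite !inE /distinguishes.
  by case/orP=> /eqP->; rewrite ?sxy ?txy eqxx.
rewrite ltnNge; apply/negP; rewrite leq_eqVlt ltnS leq_eqVlt ltnS leqn0 cards_eq0.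
case/or3P=> [/cards2P[s [t [_ defS]]]|/cards1P[s defS]|/eqP defS].
- by apply: (no_cover s t); rewrite defS.
- by apply: (no_cover s s) => w; rewrite defS !inE => ->.
- by apply: (no_cover x0 x0) => w; rewrite defS inE.
Qed.

(** * Coordinates and distances in theta graphs *)

Definition path0 : 'I_3 := @Ordinal 3 0 isT.
Definition path1 : 'I_3 := @Ordinal 3 1 isT.
Definition path2 : 'I_3 := @Ordinal 3 2 isT.

Lemma path_cases (P : 'I_3 -> Prop) : P path0 -> P path1 -> P path2 -> forall i, P i.
Proof.
move=> P0 P1 P2 [[|[|[|//]]] lti].
- by rewrite (_ : Ordinal lti = path0) //; apply: val_inj.
- by rewrite (_ : Ordinal lti = path1) //; apply: val_inj.
- by rewrite (_ : Ordinal lti = path2) //; apply: val_inj.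
Qed.

(** Coordinates of a vertex: a path on which it lies and its position there; the
    ends [u] and [v] are attributed to the first path. *)
Definition theta_coord p q r (x : theta_vertex p q r) : 'I_3 * nat :=
  match x with
  | inl b => (path0, if b then p else 0)
  | inr t => (tag t, (tagged t).+1)
  end.

Section Coordinates.

Variables p q r : nat.
Hypotheses (p_gt0 : 0 < p) (q_gt0 : 0 < q) (r_gt0 : 0 < r).

Lemma theta_length_gt0 i : 0 < theta_length p q r i.
Proof. by elim/path_cases: i. Qed.

Lemma theta_coord_bound (x : theta_vertex p q r) :
  (theta_coord x).2 <= theta_length p q r (theta_coord x).1.
Proof.
case: x => [[]|[i j]] //=.
exact: leq_trans (ltn_ord j) (leq_pred _).
Qed.

Lemma theta_coordK (x : theta_vertex p q r) :
  theta_point p q r (theta_coord x).1 (theta_coord x).2 = x.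
Proof.
case: x => [[]|[i j]] /=; [|by []|exact: theta_point_inner].
exact: (theta_point_end (theta_length_gt0 path0)).
Qed.

(** The only ambiguity of coordinates is at the ends [u] and [v]. *)
Lemma theta_coord_point i k : k <= theta_length p q r i ->
  [\/ theta_coord (theta_point p q r i k) = (i, k),
      k = 0 /\ theta_coord (theta_point p q r i k) = (path0, 0)
    | k = theta_length p q r i /\
      theta_coord (theta_point p q r i k) = (path0, p)].
Proof.
case: k => [|k] lek; first by apply: Or32.
move: (lek); rewrite leq_eqVlt => /predU1P[kL|ltk].
  by apply: Or33; split=> //; rewrite kL theta_point_end ?theta_length_gt0.
have ltk' : k < (theta_length p q r i).-1 by rewrite -ltnS prednK ?theta_length_gt0.
by apply: Or31; rewrite (theta_point_inner (Ordinal ltk')).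
Qed.

Lemma theta_edge i k : k < theta_length p q r i ->
  theta p q r (theta_point p q r i k) (theta_point p q r i k.+1).
Proof.
move=> ltk; apply/existsP; exists i; apply/existsP; exists (Ordinal ltk).
by rewrite !eqxx.
Qed.

End Coordinates.

(** The distance in [theta p p r], for [p <= r <= p + 2], between the [a]-th
    vertex of the [i]-th path and the [b]-th vertex of the [j]-th path; here
    [(a - b) + (b - a)] is the absolute difference. *)
Definition theta_dist p r (i : 'I_3) (a : nat) (j : 'I_3) (b : nat) : nat :=
  let L := theta_length p p r in
  if i == j then minn ((a - b) + (b - a)) (L i + p - ((a - b) + (b - a)))
  else minn (a + b) (L i + L j - (a + b)).

Section Distances.

Variables p r : nat.
Hypotheses (p_gt0 : 0 < p) (le_pr : p <= r) (le_rp2 : r <= p.+2).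

Let L := theta_length p p r.
Let pt := theta_point p p r.

Let theta_lengthE : (L path0 = p) * (L path1 = p) * (L path2 = r).
Proof. by []. Qed.

Let path_eqE :=
  ((erefl : (path0 == path1) = false), (erefl : (path0 == path2) = false),
   (erefl : (path1 == path0) = false), (erefl : (path1 == path2) = false),
   (erefl : (path2 == path0) = false), (erefl : (path2 == path1) = false)).

Lemma theta_dist_u i a j : a <= L i ->
  theta_dist p r i a j 0 = theta_dist p r i a path0 0.
Proof.
rewrite /theta_dist -/L.
by elim/path_cases: i; elim/path_cases: j; rewrite ?path_eqE ?eqxx ?theta_lengthE; lia.
Qed.

Lemma theta_dist_v i a j : a <= L i ->
  theta_dist p r i a j (L j) = theta_dist p r i a path0 p.
Proof.
rewrite /theta_dist -/L.
by elim/path_cases: i; elim/path_cases: j; rewrite ?path_eqE ?eqxx ?theta_lengthE; lia.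
Qed.

Lemma theta_dist_coord i a j b : a <= L i -> b <= L j ->
  theta_dist p r i a (theta_coord (pt j b)).1 (theta_coord (pt j b)).2
    = theta_dist p r i a j b.
Proof.
have r_gt0 := leq_trans p_gt0 le_pr.
move=> lea leb; case: (theta_coord_point p_gt0 p_gt0 r_gt0 leb); rewrite -/pt.
- by move=> ->.
- by case=> -> ->; rewrite /= (theta_dist_u j).
- by case=> -> ->; rewrite /= (theta_dist_v j).
Qed.

Lemma theta_dist_step i a j k : a <= L i -> k < L j ->
  theta_dist p r i a j k <= (theta_dist p r i a j k.+1).+1 /\
  theta_dist p r i a j k.+1 <= (theta_dist p r i a j k).+1.
Proof.
rewrite /theta_dist -/L.
by elim/path_cases: i; elim/path_cases: j; rewrite ?path_eqE ?eqxx ?theta_lengthE; lia.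
Qed.

Lemma theta_dist0 i a j b : a <= L i -> b <= L j ->
  (theta_dist p r i a j b == 0) =
  [|| (i == j) && (a == b), (a == 0) && (b == 0) | (a == L i) && (b == L j)].
Proof.
rewrite /theta_dist -/L.
by elim/path_cases: i; elim/path_cases: j; rewrite ?path_eqE ?eqxx ?theta_lengthE; lia.
Qed.

(** From an internal vertex one of the two neighbours on its path is nearer; from
    [u] or [v] one has to choose the right path. *)
Lemma theta_dist_descent i a j b : a <= L i -> b <= L j ->
    0 < theta_dist p r i a j b ->
  exists j' b' c, [/\ b' <= L j', c <= L j', pt j' b' = pt j b,
    c = b'.+1 \/ b' = c.+1 & theta_dist p r i a j' c < theta_dist p r i a j b].
Proof.
have r_gt0 := leq_trans p_gt0 le_pr.
have L_gt0 := theta_length_gt0 p_gt0 p_gt0 r_gt0.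
have ptv j1 j2 : pt j1 (L j1) = pt j2 (L j2) by rewrite /pt !theta_point_end.
move=> lea leb dpos.
have [b0|b_gt0] := posnP b; first subst b.
  (* At [u] the path [i] of the base vertex is the right one, unless the base
     vertex is [v], for which [i] may be the longer third path. *)
  exists (if (a == L i) then path0 else i), 0, 1; split=> //.
  - by left.
  move: lea dpos; rewrite /theta_dist -/L.
  case: (eqVneq a (L i)) => [->|]; elim/path_cases: i;
    elim/path_cases: j leb; rewrite ?path_eqE ?eqxx ?theta_lengthE; lia.
have [bL|b_ltL] := eqVneq b (L j); first subst b.
  (* Likewise at [v], with the exception of the base vertex [u]. *)
  exists (if (a == 0) then path0 else i).
  exists (L (if (a == 0) then path0 else i)).
  exists (L (if (a == 0) then path0 else i)).-1; split=> //.
  - by rewrite leq_pred.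
  - by right; rewrite prednK ?L_gt0.
  move: lea dpos; rewrite /theta_dist -/L.
  case: (eqVneq a 0) => [->|]; elim/path_cases: i;
    elim/path_cases: j {leb b_gt0}; rewrite ?path_eqE ?eqxx ?theta_lengthE; lia.
have [lt|ge] := ltnP (theta_dist p r i a j b.-1) (theta_dist p r i a j b).
  by exists j, b, b.-1; split=> //; [lia|right; lia].
exists j, b, b.+1; split=> //; [lia|by left|].
move: lea leb dpos b_ltL ge; rewrite /theta_dist -/L.
by elim/path_cases: i; elim/path_cases: j; rewrite ?path_eqE ?eqxx ?theta_lengthE; lia.
Qed.

Theorem dist_theta i a j b : a <= L i -> b <= L j ->
  dist (theta p p r) (pt i a) (pt j b) = theta_dist p r i a j b.
Proof.
move=> lea leb; rewrite -(theta_dist_coord lea leb).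
have r_gt0 := leq_trans p_gt0 le_pr.
have L_gt0 := theta_length_gt0 p_gt0 p_gt0 r_gt0.
pose f (x : theta_vertex p p r) := theta_dist p r i a (theta_coord x).1 (theta_coord x).2.
have fE k c : c <= L k -> f (pt k c) = theta_dist p r i a k c.
  by move=> lec; rewrite /f theta_dist_coord.
have f0 x : (f x == 0) = (x == pt i a).
  apply/idP/eqP=> [|->]; last by rewrite fE // theta_dist0 // !eqxx.
  have lex := theta_coord_bound x; rewrite -[LHS](theta_coordK p_gt0 p_gt0 r_gt0).
  rewrite theta_dist0 // => /or3P[] /andP[/eqP Ea /eqP Eb].
  - by rewrite -Ea -Eb.
  - by rewrite Ea Eb.
  - by rewrite Ea Eb /pt !theta_point_end.
apply: (dist_characterization (f := f)) => // [x y|x].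
  case/existsP=> k /existsP[c edge]; have ltc := ltn_ord c.
  have [down up] := theta_dist_step lea ltc.
  by case/orP: edge => /andP[/eqP-> /eqP->]; rewrite -/pt !fE // ltnW.
rewrite -f0 -lt0n => fx_gt0.
have [k' [c' [c [lec' lec Ept adj lt]]]] :=
  theta_dist_descent lea (theta_coord_bound x) fx_gt0.
exists (pt k' c); last by rewrite fE.
rewrite -[x](theta_coordK p_gt0 p_gt0 r_gt0) -/pt -Ept.
by case: adj => adj; subst; [rewrite theta_sym|]; apply: theta_edge.
Qed.

(** * Three vertices that resolve the graph *)

(** The distance to [u] gives the position of a vertex on its path, except
    possibly when compared with [v], whose position depends on the path. *)
Lemma theta_dist_u_inj i k j l : k <= L i -> l <= L j ->
    theta_dist p r path0 0 i k = theta_dist p r path0 0 j l ->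
  k = l \/ k = L i \/ l = L j.
Proof.
rewrite /theta_dist -/L.
by elim/path_cases: i; elim/path_cases: j;
  rewrite ?path_eqE ?eqxx ?theta_lengthE; lia.
Qed.

Lemma theta_dist_v_inj j l : 1 < p -> l <= L j ->
    theta_dist p r path0 0 path0 p = theta_dist p r path0 0 j l ->
    theta_dist p r path0 1 path0 p = theta_dist p r path0 1 j l ->
  l = L j.
Proof.
rewrite /theta_dist -/L.
by elim/path_cases: j; rewrite ?path_eqE ?eqxx ?theta_lengthE; lia.
Qed.

Lemma theta_resolving_distances i k j l : 1 < p -> k <= L i -> l <= L j ->
    theta_dist p r path0 0 i k = theta_dist p r path0 0 j l ->
    theta_dist p r path0 1 i k = theta_dist p r path0 1 j l ->
    theta_dist p r path1 1 i k = theta_dist p r path1 1 j l ->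
  theta_dist p r i k j l = 0.
Proof.
move=> p_gt1 lek lel du d0 d1; have [kl|[kL|lL]] := theta_dist_u_inj lek lel du.
- subst l; move: lek lel {du} d0 d1; rewrite /theta_dist -/L.
  elim/path_cases: i; elim/path_cases: j;
    rewrite ?path_eqE ?eqxx ?theta_lengthE; lia.
- subst k; move: du d0; rewrite !theta_dist_v // => du d0.
  rewrite (theta_dist_v_inj _ lel du d0) //.
  by apply/eqP; rewrite theta_dist0 // !eqxx !orbT.
- subst l; move: du d0; rewrite !theta_dist_v // => /esym du /esym d0.
  rewrite (theta_dist_v_inj _ lek du d0) //.
  by apply/eqP; rewrite theta_dist0 // !eqxx !orbT.
Qed.

Lemma metric_dim_theta_le3 : 1 < p -> metric_dim (theta p p r) <= 3.
Proof.
move=> p_gt1; have r_gt0 := leq_trans p_gt0 le_pr.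
pose S := [set pt path0 0; pt path0 1; pt path1 1].
have cardS : #|S| <= 3.
  by rewrite /S setUC cardsU1 cards2 (@leq_add _ _ 1 2) ?leq_b1 // ltnS leq_b1.
apply: leq_trans cardS; apply: metric_dim_le.
apply/forallP=> x; apply/forallP=> y; apply/implyP; apply: contraR.
rewrite negb_exists => /forallP same.
have {}same s : s \in S -> dist (theta p p r) s x = dist (theta p p r) s y.
  by move=> sS; move: (same s); rewrite sS negbK => /eqP.
rewrite -(dist_eq0 (theta p p r)).
move: same; rewrite -[x](theta_coordK p_gt0 p_gt0 r_gt0).
rewrite -[y](theta_coordK p_gt0 p_gt0 r_gt0) -/pt.
have := theta_coord_bound x; have := theta_coord_bound y; rewrite -/L.
move: (theta_coord x) (theta_coord y) => [i k] [j l] /= lel lek same.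
rewrite dist_theta //; apply/eqP; apply: theta_resolving_distances => //.
all: by rewrite -!dist_theta //; apply: same; rewrite !inE eqxx ?orbT.
Qed.

(** * Two vertices never resolve the graph *)

(** The vertices with coordinates [(i, a)] and [(j, b)] do not resolve some pair
    of distinct vertices. *)
Definition unresolving (i : 'I_3) (a : nat) (j : 'I_3) (b : nat) : Prop :=
  exists k c l d, [/\ c <= L k, d <= L l, 0 < theta_dist p r k c l d,
    theta_dist p r i a k c = theta_dist p r i a l d &
    theta_dist p r j b k c = theta_dist p r j b l d].

Lemma unresolving_sym i a j b : unresolving i a j b -> unresolving j b i a.
Proof. by case=> k [c [l [d [? ? ? ? ?]]]]; exists k, c, l, d. Qed.

(** The symmetry exchanging [u] and [v]. *)
Lemma unresolving_rev i a j b : a <= L i -> b <= L j ->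
  unresolving i (L i - a) j (L j - b) -> unresolving i a j b.
Proof.
have rev i1 a1 i2 a2 : a1 <= L i1 -> a2 <= L i2 ->
    theta_dist p r i1 (L i1 - a1) i2 (L i2 - a2) = theta_dist p r i1 a1 i2 a2.
  rewrite /theta_dist -/L => le1 le2.
  by case: eqP => [E|_]; first subst i2; lia.
move=> lea leb [k [c [l [d [lec led dpos da db]]]]].
exists k, (L k - c), l, (L l - d); split; rewrite ?leq_subr ?rev //.
- by rewrite -rev ?leq_subr // subKn // da -[in RHS]rev ?leq_subr // subKn.
- by rewrite -rev ?leq_subr // subKn // db -[in RHS]rev ?leq_subr // subKn.
Qed.

(** The symmetry exchanging the two paths of length [p]. *)
Definition swap01 (i : 'I_3) : 'I_3 :=
  if i == path0 then path1 else if i == path1 then path0 else i.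

Lemma unresolving_swap01 i a j b :
  unresolving (swap01 i) a (swap01 j) b -> unresolving i a j b.
Proof.
have swapK : involutive swap01 by elim/path_cases.
have L_swap k : L (swap01 k) = L k by elim/path_cases: k.
have swap i1 a1 i2 a2 :
    theta_dist p r (swap01 i1) a1 (swap01 i2) a2 = theta_dist p r i1 a1 i2 a2.
  by rewrite /theta_dist -/L !L_swap (can_eq swapK).
case=> k [c [l [d [lec led dpos da db]]]].
exists (swap01 k), c, (swap01 l), d; rewrite !L_swap swap; split=> //.
- by rewrite -swap swapK da -swap swapK.
- by rewrite -swap swapK db -swap swapK.
Qed.

(* Checks by linear arithmetic that the [c]-th vertex of path [k] and the [d]-th
   vertex of path [l] form an unresolved pair. *)
Ltac witness k c l d :=
  exists k, c, l, d; rewrite /theta_dist -/L ?path_eqE ?eqxx ?theta_lengthE;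
  split; lia.

Hypothesis p_gt1 : 1 < p.

Lemma unresolving_path22 a b : unresolving path2 a path2 b.
Proof. by witness path0 1 path1 1. Qed.

Lemma unresolving_path00 a b : a <= p -> b <= p -> unresolving path0 a path0 b.
Proof.
have near_u a' b' : a' < p -> b' < p -> unresolving path0 a' path0 b'.
  by move=> lta ltb; witness path1 1 path2 1.
move=> lea leb; have [lta|gea] := ltnP a p; have [ltb|geb] := ltnP b p.
- exact: near_u.
- (* If [a = 0], the two vertices are [u] and [v], which also lie on the third
     path. *)
  have [a0|a_gt0] := posnP a; first by witness path0 1 path1 1.
  by apply: unresolving_rev => //; apply: near_u; rewrite !theta_lengthE; lia.
- have [b0|b_gt0] := posnP b; first by witness path0 1 path1 1.
  by apply: unresolving_rev => //; apply: near_u; rewrite !theta_lengthE; lia.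
- by apply: unresolving_rev => //; apply: near_u; rewrite !theta_lengthE; lia.
Qed.

Lemma unresolving_path11 a b : a <= p -> b <= p -> unresolving path1 a path1 b.
Proof. by move=> lea leb; apply/unresolving_swap01/unresolving_path00. Qed.

(** The cycle formed by the first two paths has length [2p]. *)
Lemma unresolving_path01 a b : 0 < a < p -> 0 < b < p ->
  unresolving path0 a path1 b.
Proof.
have near_u a' b' : 0 < a' < p -> 0 < b' < p -> a' + b' < p ->
    unresolving path0 a' path1 b'.
  move=> a_in b_in ab_lt; have [ab|ba] := leqP a' b'.
    by witness path2 (p - a' - b') path0 (p - b' + a').
  by witness path2 (p - a' - b') path1 (p - a' + b').
move=> a_in b_in; have [ab_lt|ab_gt|ab_eq] := ltngtP (a + b) p.
- exact: near_u.
- by apply: unresolving_rev; rewrite !theta_lengthE; [lia|lia|apply: near_u; lia].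
- by witness path0 a.-1 path0 a.+1.
Qed.

Variable h : nat.
Hypothesis h_half : p + r = h.*2.

(** The cycle formed by the first and the third path has length [2h]. *)
Lemma unresolving_path02 a b : 0 < a < p -> 0 < b < r ->
  unresolving path0 a path2 b.
Proof.
have near_u a' b' : 0 < a' < p -> 0 < b' < r -> a' + b' < h ->
    unresolving path0 a' path2 b'.
  move=> a_in b_in ab_lt; have [ab|ba] := leqP (a' + h) (b' + p).
    by witness path1 (h - a' - b') path0 (h - b' + a').
  by witness path1 (h - a' - b') path2 (h - a' + b').
move=> a_in b_in; have [ab_lt|ab_gt|ab_eq] := ltngtP (a + b) h.
- exact: near_u.
- by apply: unresolving_rev; rewrite !theta_lengthE; [lia|lia|apply: near_u; lia].
- by witness path0 a.-1 path0 a.+1.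
Qed.

Lemma unresolving_path12 a b : 0 < a < p -> 0 < b < r ->
  unresolving path1 a path2 b.
Proof. by move=> a_in b_in; apply/unresolving_swap01/unresolving_path02. Qed.

Lemma unresolving_same_path i a b : a <= L i -> b <= L i ->
  unresolving i a i b.
Proof.
elim/path_cases: i => lea leb.
- exact: unresolving_path00.
- exact: unresolving_path11.
- exact: unresolving_path22.
Qed.

Lemma unresolving_inner i a j b : 0 < a < L i -> 0 < b < L j ->
  unresolving i a j b.
Proof.
have [->|] := eqVneq i j.
  by move=> /andP[_ /ltnW lea] /andP[_ /ltnW leb]; apply: unresolving_same_path.
elim/path_cases: i; elim/path_cases: j => // _ a_in b_in.
- exact: unresolving_path01.
- exact: unresolving_path02.
- exact/unresolving_sym/unresolving_path01.
- exact: unresolving_path12.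
- exact/unresolving_sym/unresolving_path02.
- exact/unresolving_sym/unresolving_path12.
Qed.

Lemma theta_inner_or_end (x : theta_vertex p p r) :
  (exists i a, 0 < a < L i /\ pt i a = x) \/
  (forall j, exists2 a, a <= L j & pt j a = x).
Proof.
have r_gt0 := leq_trans p_gt0 le_pr.
have L_gt0 := theta_length_gt0 p_gt0 p_gt0 r_gt0.
have xE := theta_coordK p_gt0 p_gt0 r_gt0 x; have lex := theta_coord_bound x.
move: xE lex; case: (theta_coord x) => i a /= xE lea.
have [a0|a_gt0] := posnP a; first by right=> j; exists 0; rewrite // -xE a0.
have [aL|a_neL] := eqVneq a (L i).
  by right=> j; exists (L j); rewrite // -xE aL /pt !theta_point_end.
by left; exists i, a; rewrite a_gt0 ltn_neqAle a_neL.
Qed.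

Lemma unresolved_pair s t : exists x y,
  [/\ x != y, dist (theta p p r) s x = dist (theta p p r) s y
    & dist (theta p p r) t x = dist (theta p p r) t y].
Proof.
suff [i [a [j [b [lea leb <- <- [k [c [l [d [lec led dpos da db]]]]]]]]]] :
    exists i a j b, [/\ a <= L i, b <= L j, pt i a = s, pt j b = t
                      & unresolving i a j b].
  exists (pt k c), (pt l d); rewrite !dist_theta //; split=> //.
  by rewrite -(dist_eq0 (theta p p r)) dist_theta // -lt0n.
have [[i [a [a_in <-]]]|s_end] := theta_inner_or_end s; last first.
  have tE := theta_coordK p_gt0 p_gt0 (leq_trans p_gt0 le_pr) t.
  have let' := theta_coord_bound t.
  have [a lea sE] := s_end (theta_coord t).1.
  exists (theta_coord t).1, a, (theta_coord t).1, (theta_coord t).2.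
  by split=> //; apply: unresolving_same_path.
have /andP[_ /ltnW lea] := a_in.
have [[j [b [b_in <-]]]|t_end] := theta_inner_or_end t.
  have /andP[_ /ltnW leb] := b_in.
  by exists i, a, j, b; split=> //; apply: unresolving_inner.
have [b leb <-] := t_end i.
by exists i, a, i, b; split=> //; apply: unresolving_same_path.
Qed.

End Distances.

(** The condition [p + r = h.*2] says that the cycles through the path of length
    [r] are even; vertices on them have antipodes only in that case. *)
Lemma metric_dim_theta p r h : 1 < p -> p <= r -> r <= p.+2 -> p + r = h.*2 ->
  metric_dim (theta p p r) = 3.
Proof.
move=> p_gt1 le_pr le_rp2 h_half; have p_gt0 := ltnW p_gt1.
apply/eqP; rewrite eqn_leq metric_dim_theta_le3 //=.
apply: (metric_dim_gt2 (theta_u p p r)) => s t.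
exact: unresolved_pair h_half s t.
Qed.

Theorem theorem8 (p : nat) (hp : 2 <= p) :
  metric_dim (theta p p p) = 3 /\ metric_dim (theta p p p.+2) = 3.
Proof.
split.
- by apply: (@metric_dim_theta p p p) => //; lia.
- by apply: (@metric_dim_theta p p.+2 p.+1) => //; lia.
Qed.
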